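(* Let $K$ be a number field with ring of integers $\mathcal{O}_K$, and let $R\subset\mathcal{O}_K\setminus\{0\}$ be a set of representatives for the nonzero elements of $\mathcal{O}_K$ modulo squares. Let $g(z)\in K[z]$ be a bicritical polynomial of degree $d\ge 3$ whose set of critical points $\{\gamma_1,\gamma_2\}$ is not contained in $K$. Then $g$ is conjugate to a map of the form $a\,\mathcal{P}_{d,D}(z)+c$ for some $a,c\in K$ and some $D\in R$.
   Context: Critical points of $g$ are the $\alpha\in\overline K$ with $g'(\alpha)=0$; $g$ is bicritical if it has exactly two distinct critical points. (Under the hypotheses of the claim, $d$ is necessarily odd.) Polynomials $f,g$ are conjugate if $g=\phi\circ f\circ\phi^{-1}$ for some affine map $\phi(z)=\alpha z+\beta$ with $\alpha,\beta\in\overline K$, $\alpha\ne0$. Two nonzero elements $x,y\in\mathcal{O}_K$ are equal modulo squares if $xu^2=yv^2$ for some nonzero $u,v\in\mathcal{O}_K$. For $D\in\mathcal{O}_K\setminus\{0\}$ and odd $d\ge3$, $\mathcal{P}_{d,D}(z)\in K[z]$ is the polynomial determined by $\mathcal{P}_{d,D}'(z)=(z^2-D)^{(d-1)/2}$ and $\mathcal{P}_{d,D}(0)=0$, i.e. $$\mathcal{P}_{d,D}(z)=\sum_{j=0}^{(d-1)/2}(-D)^{\frac{d-1}{2}-j}\binom{\frac{d-1}{2}}{j}\frac{z^{2j+1}}{2j+1}.$$ *)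

(* Defs.v *)
From HB Require Import structures.
From mathcomp Require Import all_boot all_order all_algebra all_field.

Set Implicit Arguments.
Unset Strict Implicit.
Unset Printing Implicit Defensive.

Import Order.TTheory GRing.Theory Num.Theory.
Local Open Scope ring_scope.

(* A number field is a [fieldExtType rat]: a finite extension of Q. *)

Definition ring_of_integers (K : fieldExtType rat) (x : K) : Prop :=
  integralOver (intr : int -> K) x.

Definition eq_mod_squares (K : fieldExtType rat) (x y : K) : Prop :=
  exists u v : K,
    [/\ ring_of_integers u, u != 0, ring_of_integers v, v != 0
      & x * u ^+ 2 = y * v ^+ 2].

(* R contains exactly one element of each class of nonzero algebraic integers
   modulo squares. *)
Definition square_class_representatives
    (K : fieldExtType rat) (R : K -> Prop) : Prop :=
  [/\ forall x, R x -> ring_of_integers x /\ x != 0,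
      forall x, ring_of_integers x -> x != 0 ->
        exists2 y, R y & eq_mod_squares x y
    & forall x y, R x -> R y -> eq_mod_squares x y -> x = y].

Definition is_algebraic_closure (K : fieldType) (Kbar : closedFieldType)
    (iota : {rmorphism K -> Kbar}) : Prop :=
  forall x : Kbar, algebraicOver iota x.

Definition critical_point (F : fieldType) (g : {poly F}) (alpha : F) : Prop :=
  g^`().[alpha] = 0.

Definition bicritical (F : fieldType) (g : {poly F}) : Prop :=
  exists gamma1 gamma2 : F, gamma1 <> gamma2 /\
    forall alpha, critical_point g alpha <-> alpha = gamma1 \/ alpha = gamma2.

Definition affine (F : fieldType) (alpha beta : F) : {poly F} :=
  alpha *: 'X + beta%:P.

Definition affine_inv (F : fieldType) (alpha beta : F) : {poly F} :=
  affine alpha^-1 (- (alpha^-1 * beta)).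

Lemma affineK (F : fieldType) (alpha beta : F) : alpha != 0 ->
  affine alpha beta \Po affine_inv alpha beta = 'X /\
  affine_inv alpha beta \Po affine alpha beta = 'X.
Proof.
move=> a0; rewrite /affine_inv /affine.
split; rewrite comp_polyD comp_polyZ comp_polyX comp_polyC scalerDr scalerA.
  by rewrite divff // scale1r -addrA -mul_polyC -polyCM mulrN mulVKf //
     -polyCD addNr addr0.
by rewrite mulVf // scale1r -addrA -mul_polyC -polyCM -polyCD subrr addr0.
Qed.

(* g = phi o f o phi^-1 for some affine map phi over F; [p \Po q] is the
   composition p o q. *)
Definition conjugate (F : fieldType) (f g : {poly F}) : Prop :=
  exists alpha beta : F, alpha != 0 /\
    g = affine alpha beta \Po (f \Po affine_inv alpha beta).

(* Only meaningful for d odd, in which case (d.-1)./2 is exactly (d - 1) / 2. *)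
Definition P_poly (F : fieldType) (d : nat) (D : F) : {poly F} :=
  \sum_(j < ((d.-1)./2).+1)
    (((- D) ^+ ((d.-1)./2 - j) * 'C((d.-1)./2, j)%:R / (2 * j + 1)%:R)
      *: 'X^(2 * j + 1)).

Lemma P_poly_deriv (F : fieldType) (d : nat) (D : F) : [pchar F] =i pred0 ->
  (P_poly d D)^`() = ('X^2 - D%:P) ^+ (d.-1)./2.
Proof.
move=> F0; rewrite addrC -polyCN exprDn /P_poly raddf_sum /=.
apply: eq_bigr => j _.
have nz : (2 * j + 1)%:R != 0 :> F.
  by rewrite (pcharf0P F).1 // addn1.
rewrite derivZ derivXn addn1 /= -scaler_nat scalerA -(addn1 (2 * j)) divfK //.
by rewrite -exprM -polyC_exp mul_polyC mulr_natr scalerMnl.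
Qed.

Lemma P_poly_at0 (F : fieldType) (d : nat) (D : F) : (P_poly d D).[0] = 0.
Proof.
rewrite /P_poly horner_sum big1 // => j _.
by rewrite hornerZ hornerXn addn1 expr0n mulr0.
Qed.

(* Main.v *)
Require Import Defs.
From HB Require Import structures.
From mathcomp Require Import all_boot all_order all_algebra all_field.
From mathcomp Require Import ring.

(** The squarefree part of g' has coefficients in K and, over Kbar, is a scalar
    multiple of (X - gamma1) (X - gamma2), so p := (X - gamma1) (X - gamma2) lies
    in K[X]; it has no root in K, hence is irreducible, and therefore g' = c p^n
    with c in K: this forces the two critical points to have equal multiplicity.
    Completing the square, p = (X - e)^2 - D0, and after rescaling by an integer
    D0 = D w^2 with D in R. The substitution z := w z + e then turns g' into
    c w^(2n) (z^2 - D)^n, and antiderivatives differ by a constant. *)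

Set Implicit Arguments.
Unset Strict Implicit.
Unset Printing Implicit Defensive.

Import Order.TTheory GRing.Theory Num.Theory.
Local Open Scope ring_scope.

(** * Characteristic zero, squarefree parts and descent from an algebraically closed field *)

Lemma pchar_rat_fieldExt (K : fieldExtType rat) : [pchar K] =i pred0.
Proof. by move=> p; rewrite (pchar_lalg K) pchar_num. Qed.

Lemma intr_fieldExt_eq0 (K : fieldExtType rat) (k : int) :
  (k%:~R == 0 :> K) = (k == 0).
Proof. by rewrite -(rmorph_int (in_alg K)) fmorph_eq0 intr_eq0. Qed.

Lemma root_squarefree_part (F : fieldType) (p : {poly F}) (x : F) :
    [pchar F] =i pred0 -> p != 0 ->
  root (p %/ gcdp p p^`()) x = root p x.
Proof.
move=> F0 p0; have gp := dvdp_gcdl p p^`().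
have E := divpK gp.
apply/idP/idP => [r1|rx]; first by rewrite -E rootM r1.
apply/negPn/negP => nrx.
have [m [u]] := multiplicity_XsubC p x; rewrite p0 /= => nru Ep.
have dg : ('X - x%:P) ^+ m %| gcdp p p^`().
  have cop : coprimep (('X - x%:P) ^+ m) (p %/ gcdp p p^`()).
    by rewrite coprimep_expl // coprimep_sym coprimep_XsubC.
  by rewrite -(Gauss_dvdpr _ cop) E Ep dvdp_mull.
have := dvdp_trans dg (dvdp_gcdr _ _).
case: m Ep {dg} => [|m] Ep.
  by move: rx; rewrite Ep mulr1 (negPf nru).
(* Modulo the (m+1)-st power only (m+1) u (X - x)^m remains of the derivative; as m+1 is invertible,
   X - x would divide u. *)
rewrite Ep derivM dvdp_addr; last exact: dvdp_mull.
rewrite deriv_exp derivXsubC mul1r /=.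
rewrite -scaler_nat -scalerAr dvdpZr ?((pcharf0P F).1 F0) //.
by rewrite exprS dvdp_mul2r ?expf_neq0 ?polyXsubC_eq0 // dvdp_XsubCl (negPf nru).
Qed.

Lemma root_pair_symmetric (F : fieldType) (L : closedFieldType)
    (iota : {rmorphism F -> L}) (q : {poly F}) (x y : L) :
    [pchar F] =i pred0 -> q != 0 -> x != y ->
    (forall z, root (map_poly iota q) z = (z == x) || (z == y)) ->
  exists s t : F, iota s = x + y /\ iota t = x * y.
Proof.
move=> F0 q0 xy rq.
pose p := q %/ gcdp q q^`().
have p0 : p != 0 by rewrite dvdp_div_eq0 ?dvdp_gcdl.
have rp z : root (map_poly iota p) z = (z == x) || (z == y).
  rewrite /p map_divp gcdp_map -deriv_map root_squarefree_part ?map_poly_eq0 //.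
  by move=> n; rewrite -(F0 n) (fmorph_pchar iota).
have [r Er] := closed_field_poly_normal (map_poly iota p).
have lc0 : lead_coef (map_poly iota p) != 0 by rewrite lead_coef_eq0 map_poly_eq0.
(* The squarefree part is separable, so its roots are listed without repetition and the list is [x],
   [y] up to order. *)
have ur : uniq r.
  rewrite -separable_prod_XsubC.
  rewrite -(eqp_separable (eqp_scale _ lc0)) -Er separable_map.
  exact: make_separable.
have pr : perm_eq r [:: x; y].
  apply: uniq_perm => //=; first by rewrite inE xy.
  by move=> z; rewrite !inE -rp Er rootZ // root_prod_XsubC.
move: Er; rewrite (perm_big _ pr) /= !big_cons big_nil mulr1 lead_coef_map.
have c0 : iota (lead_coef p) != 0 by rewrite fmorph_eq0 lead_coef_eq0.
move: (lead_coef p) c0 => c c0.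
have -> : ('X - x%:P) * ('X - y%:P) = 'X^2 - (x + y) *: 'X + (x * y)%:P.
  by rewrite -mul_polyC polyCD polyCM; ring.
move=> Er.
have Ec i : iota p`_i = (iota c *: ('X^2 - (x + y) *: 'X + (x * y)%:P))`_i.
  by rewrite -Er coef_map.
(* Vieta's formulas for [p], whose leading coefficient is [c]. *)
exists (- p`_1 / c), (p`_0 / c); rewrite !fmorph_div rmorphN /= !Ec.
rewrite !(coefZ, coefD, coefN, coefXn, coefX, coefC) /=.
by split; field.
Qed.

(** A nonconstant [q] has a root in [L], shared with [p]; so [p] and [q] are not coprime, and the
    irreducible [p] divides [q]. Induction applies to the quotient. *)
Lemma eq_scale_exp_irreducible (F : fieldType) (L : closedFieldType)
    (iota : {rmorphism F -> L}) (p q : {poly F}) :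
    irreducible_poly p -> q != 0 ->
    (forall z, root (map_poly iota q) z -> root (map_poly iota p) z) ->
  exists c n, q = c *: p ^+ n.
Proof.
move=> irp; have [m] := ubnP (size q); elim: m q => // m IH q ltqm q0 rqp.
have [sq1|sq1] := eqVneq (size (map_poly iota q)) 1.
  exists q`_0, 0%N; rewrite expr0 alg_polyC; apply: size1_polyC.
  by rewrite -(size_map_poly iota) sq1.
have [z rz] := closed_rootP _ sq1.
have pq : p %| q.
  apply/negPn/negP => npq.
  have : coprimep (map_poly iota p) (map_poly iota q).
    by rewrite coprimep_map irreducible_poly_coprime.
  by move/coprimep_root => /(_ z (rqp z rz)); rewrite -/(root _ z) rz.
have E := divpK pq.
have d0 : q %/ p != 0 by rewrite dvdp_div_eq0.
have [||c [n Ec]] := IH (q %/ p) _ d0.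
- apply: leq_trans (ltqm : (size q <= m)%N); rewrite ltn_divpl ?irredp_neq0 //.
  rewrite size_mul ?(irredp_neq0 irp) //; case: (irp) => + _.
  by case: (size p) => [|[|k]] // _; rewrite !addnS ltnS leq_addr.
- by move=> w rw; apply: rqp; rewrite -E rmorphM rootM rw.
by exists c, n.+1; rewrite -E Ec exprSr scalerAl.
Qed.

(** * Clearing denominators of an element of a number field *)

Lemma integral_multiple (K : fieldExtType rat) (x : K) :
  exists2 k : int, k != 0 & ring_of_integers (k%:~R * x).
Proof.
(* If q over int of degree n has root x and leading coefficient b, then
   b^(n-1) q, rewritten in terms of b x, is monic. *)
have /polyOver1P[p Ep] := minPolyOver 1%AS x.
have p0 : p != 0.
  by rewrite -(map_poly_eq0 (in_alg K)) -Ep monic_neq0 ?monic_minPoly.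
have rp : root (map_poly (in_alg K) p) x by rewrite -Ep root_minPoly.
have [q [a a0 Eq]] := rat_poly_scale p.
have q0 : q != 0.
  by apply: contraNneq p0 => q0; rewrite Eq q0 rmorph0 scaler0.
have rq : (map_poly (intr : int -> K) q).[x] = 0.
  move: rp; rewrite Eq map_polyZ rootZ; last first.
    by rewrite fmorph_eq0 invr_eq0 intr_eq0.
  rewrite -map_poly_comp => /rootP <-; congr (_.[x]).
  by apply: eq_map_poly => z; apply: esym (rmorph_int (in_alg K) z).
pose n := (size q).-1; have sq : size q = n.+1 by rewrite prednK ?size_poly_gt0.
pose b := lead_coef q; have b0 : b != 0 by rewrite lead_coef_eq0.
exists b => //.
exists ('X^n + \poly_(i < n) (q`_i * b ^+ (n.-1 - i))).
  rewrite monicE lead_coefDl ?lead_coefXn // size_polyXn ltnS.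
  exact: size_poly.
have n0 : (0 < n)%N.
  rewrite lt0n; apply: contraNneq q0 => n0.
  move: rq; have /size1_polyC -> : (size q <= 1)%N by rewrite sq n0.
  by rewrite map_polyC hornerC polyC_eq0 => /eqP; rewrite intr_fieldExt_eq0.
apply/rootP; rewrite rmorphD /= map_polyXn hornerD hornerXn.
(* The value at b x is b^(n-1) q(x); one more factor b turns it into b^n q(x), which is compared
   term by term. *)
apply: (mulfI (_ : (b%:~R : K) != 0)); first by rewrite intr_fieldExt_eq0.
rewrite mulr0 -[RHS](mulr0 (b%:~R ^+ n)) -rq.
rewrite -[in RHS](coefK q) !poly_def sq big_ord_recr /= !rmorphD !rmorph_sum /=.
rewrite hornerD !horner_sum addrC !mulrDr !mulr_sumr.
congr (_ + _).
  apply: eq_bigr => i _.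
  rewrite !map_polyZ !map_polyXn !hornerZ !hornerXn rmorphM rmorphXn /= exprMn.
  have -> : (b%:~R : K) ^+ n = b%:~R ^+ (n.-1 - i) * b%:~R * b%:~R ^+ i.
    by rewrite -exprSr -exprD addSn subnK ?prednK // -ltnS prednK.
  ring.
rewrite map_polyZ map_polyXn hornerZ hornerXn exprMn /= -/n -/b.
have -> : q`_n = b by [].
ring.
Qed.

(** * Antiderivatives and conjugation *)

Lemma deriv_eq_const (F : fieldType) (p q : {poly F}) : [pchar F] =i pred0 ->
  p^`() = q^`() -> exists c, p = q + c%:P.
Proof.
move=> F0 E; exists (p - q)`_0.
apply/eqP; rewrite addrC -subr_eq; apply/eqP; apply: size1_polyC.
apply/leq_sizeP => -[//|i] _.
have := congr1 (fun r : {poly F} => r`_i) E; rewrite !coef_deriv => /eqP.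
rewrite -subr_eq0 -mulrnBl -coefB -mulr_natr mulf_eq0 ((pcharf0P F).1 F0) orbF.
by move/eqP.
Qed.

Lemma map_conjugate (F L : fieldType) (iota : {rmorphism F -> L})
    (f g : {poly F}) :
  conjugate f g -> conjugate (map_poly iota f) (map_poly iota g).
Proof.
have mapA a b : map_poly iota (affine a b) = affine (iota a) (iota b).
  by rewrite rmorphD /= map_polyZ map_polyX map_polyC.
case=> a [b [a0 ->]]; exists (iota a), (iota b); split; first by rewrite fmorph_eq0.
by rewrite !map_comp_poly !mapA /affine_inv rmorphN rmorphM fmorphV.
Qed.

(** Conjugate by phi(z) = (z - e) / w, with inverse A(z) = w z + e. In the derivative of phi o g o A
    the factors 1/w and w cancel, leaving g'(A(z)) = c w^(2n) (z^2 - D)^n. *)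
Lemma conjugate_P_poly (F : fieldType) (d : nat) (g : {poly F}) (c e w D : F) :
    [pchar F] =i pred0 -> w != 0 ->
    g^`() = c *: (('X - e%:P) ^+ 2 - (D * w ^+ 2)%:P) ^+ (d.-1)./2 ->
  exists a b, conjugate g (a *: P_poly d D + b%:P).
Proof.
move=> F0 w0 Eg; set n := (d.-1)./2 in Eg *.
pose A : {poly F} := w *: 'X + e%:P.
have EA : affine_inv w^-1 (- (w^-1 * e)) = A.
  by rewrite /affine_inv /affine invrK mulrN opprK mulVKf.
pose f := affine w^-1 (- (w^-1 * e)) \Po (g \Po A).
have Ef : f^`() = (c * w ^+ (2 * n) *: P_poly d D)^`().
  rewrite derivZ P_poly_deriv // -/n /f /affine.
  rewrite comp_polyD comp_polyZ comp_polyX comp_polyC derivD derivZ derivC addr0.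
  rewrite deriv_comp {2}/A derivD derivZ derivX derivC addr0 alg_polyC.
  rewrite mulrC mul_polyC scalerA mulVf // scale1r Eg comp_polyZ.
  rewrite (rmorphXn (comp_poly A)) /= rmorphB rmorphXn rmorphB /=.
  rewrite comp_polyX !comp_polyC /A addrK.
  have -> : (w *: 'X) ^+ 2 - (D * w ^+ 2)%:P = w ^+ 2 *: ('X^2 - D%:P) :> {poly F}.
    by rewrite -!mul_polyC polyCM !polyC_exp; ring.
  by rewrite exprZn scalerA -exprM.
have [b Eb] := deriv_eq_const F0 Ef.
exists (c * w ^+ (2 * n)), b, w^-1, (- (w^-1 * e)).
by rewrite invr_eq0 EA -Eb.
Qed.

Theorem proposition3p4 (K : fieldExtType rat)
    (Kbar : closedFieldType) (iota : {rmorphism K -> Kbar})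
    (hKbar : is_algebraic_closure iota)
    (R : K -> Prop) (hR : square_class_representatives R)
    (d : nat) (hd : (3 <= d)%N)
    (g : {poly K}) (hdeg : size g = d.+1)
    (hbicrit : bicritical (map_poly iota g))
    (hnotK : ~ (forall gamma : Kbar, critical_point (map_poly iota g) gamma ->
                  exists x : K, gamma = iota x)) :
  exists a c D : K,
    R D /\
    conjugate (map_poly iota g) (map_poly iota (a *: P_poly d D + c%:P)).
Proof.
have K0 := pchar_rat_fieldExt K.
case: hR => RO RE _.
have sg' : size g^`() = d.
  apply/eqP; rewrite eqn_leq; apply/andP; split.
    by rewrite -ltnS -hdeg lt_size_deriv // -size_poly_gt0 hdeg.
  (* The top coefficient of g' is d times that of g, nonzero in characteristic 0. *)
  case: (d) hdeg hd => // k sg _; rewrite ltnNge; apply/negP => /leq_sizeP/(_ k (leqnn _)).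
  rewrite coef_deriv -mulr_natr => /eqP; rewrite mulf_eq0 ((pcharf0P _).1 K0) orbF.
  have -> : g`_k.+1 = lead_coef g by rewrite lead_coefE sg.
  by rewrite lead_coef_eq0 -size_poly_eq0 sg.
have g'0 : g^`() != 0 by rewrite -size_poly_gt0 sg' (leq_trans _ hd).
case: hbicrit => x [y [/eqP xy crit]].
have rg' z : root (map_poly iota g^`()) z = (z == x) || (z == y).
  rewrite -deriv_map; apply/rootP/orP => [/crit[]->|E]; rewrite ?eqxx; [by left|by right|].
  by apply/crit; case: E => /eqP; [left|right].
have [s [t [Es Et]]] := root_pair_symmetric K0 g'0 xy rg'.
pose p : {poly K} := 'X^2 - s *: 'X + t%:P.
have Ep : map_poly iota p = ('X - x%:P) * ('X - y%:P).
  rewrite rmorphD rmorphB /= map_polyZ map_polyXn map_polyX map_polyC /= Es Et.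
  by rewrite -mul_polyC polyCD polyCM; ring.
have sp : size p = 3.
  by rewrite -(size_map_poly iota) Ep size_mul ?polyXsubC_eq0 // !size_XsubC.
(* The sum [s] of the critical points lies in [K], so if one of them is in [K], both are. *)
have nrp a : ~~ root p a.
  apply/negP => ra; apply: hnotK.
  have : root (map_poly iota p) (iota a) by rewrite fmorph_root.
  rewrite Ep rootM !root_XsubC => /orP[] /eqP Ea z /crit[] ->.
  - by exists a.
  - by exists (s - a); rewrite rmorphB Es Ea; ring.
  - by exists (s - a); rewrite rmorphB Es Ea; ring.
  - by exists a.
have irp : irreducible_poly p by apply: cubic_irreducible nrp; rewrite sp.
have [|c [n Eg']] := eq_scale_exp_irreducible (iota := iota) irp g'0.
  by move=> z; rewrite rg' Ep rootM !root_XsubC.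
(* Comparing degrees gives 2n = d - 1, so d is odd and the halving is exact. *)
have En : n = (d.-1)./2.
  have c0 : c != 0 by apply: contraNneq g'0 => c0; rewrite Eg' c0 scale0r.
  rewrite -sg' Eg' size_scale //.
  have : (size (p ^+ n)).-1 = (n.*2)%N by rewrite size_exp sp mul2n.
  by move=> ->; rewrite doubleK.
have nz2 : 2 != 0 :> K by rewrite ((pcharf0P _).1 K0).
pose e := s / 2; pose D0 := e ^+ 2 - t.
have Ep2 : p = ('X - e%:P) ^+ 2 - D0%:P.
  have Ee : s = 2 * e by rewrite /e mulrC divfK.
  by rewrite /p /D0 {1}Ee polyCB polyC_exp -mul_polyC polyCM; ring.
(* Otherwise [e] would be a root of [p] in [K]. *)
have D00 : D0 != 0.
  apply: contra (nrp e) => /eqP D00.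
  by rewrite Ep2 D00 subr0 /root !hornerE subrr expr0n.
have [k k0 kD0] := integral_multiple D0.
have k0K : k%:~R != 0 :> K by rewrite intr_fieldExt_eq0.
have kI : ring_of_integers (k%:~R : K).
  exists ('X - k%:P); first exact: monicXsubC.
  by rewrite rmorphB /= map_polyX map_polyC root_XsubC.
(* [R] represents integral elements only, so [D0] is multiplied by the square k^2, which makes it
   integral. Then k^2 D0 u^2 = D v^2, whence D0 = D w^2 with w = v / (k u). *)
have [||D RD [u [v [_ u0 _ v0 E]]]] := RE (k%:~R * (k%:~R * D0)).
- by apply: integral_mul => //; apply: integral_mul.
- by rewrite !mulf_neq0.
have [_ Dn0] := RO D RD.
have [||a [b cj]] := @conjugate_P_poly K d g c e (v / (k%:~R * u)) D K0.
- by rewrite mulf_neq0 // invr_neq0 // mulf_neq0.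
- rewrite Eg' En Ep2; congr (_ *: (_ - _%:P) ^+ _).
  rewrite expr_div_n mulrA -E; field.
  by rewrite u0 k0K.
by exists a, b, D; split=> //; apply: map_conjugate.
Qed.
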